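(* Let $K\subset\mathbb{R}^n$ be a convex body and $j\in\{0,\ldots,n\}$. Then $$\max\left\{\frac{\alpha_j(K)}{\alpha_{n-j}(K)},\frac{\alpha_{n-j}(K)}{\alpha_j(K)}\right\}\le\alpha_0(K).$$ If $K$ is point-symmetric, then $\alpha_j(K)=\alpha_{n-j}(K)$. If $K$ is $0$-symmetric, then $\alpha_j(K)=\alpha_j(K^\circ)$.
   Context: A convex body is a compact convex set with nonempty interior. $K$ is $z$-symmetric if $K-z=z-K$, and point-symmetric if it is $z$-symmetric for some $z\in\mathbb{R}^n$. The polar set of $K$ is $K^\circ=\{a\in\mathbb{R}^n : a^\top x\le 1\text{ for all }x\in K\}$. For an affine subspace $U\subset\mathbb{R}^n$, $P_U$ is the orthogonal projection onto $U$ and $\Phi_U(x)=2P_U(x)-x$ is the reflection across $U$. For convex bodies $K,C\subset\mathbb{R}^n$, $R(K,C)=\inf\{\lambda>0 : K\subset z+\lambda C\text{ for some }z\in\mathbb{R}^n\}$. The $j$th Minkowski chirality is $\alpha_j(K)=\inf\{R(K,\Phi_U(K)) : U\subset\mathbb{R}^n\text{ affine subspace},\ \dim U=j\}$. *)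

(* Defs.v *)
From mathcomp Require Import all_boot all_order all_algebra.
From mathcomp Require Import all_classical all_reals all_analysis.

Set Implicit Arguments.
Unset Strict Implicit.
Unset Printing Implicit Defensive.

Import Order.TTheory GRing.Theory Num.Theory.
Import numFieldNormedType.Exports.

Local Open Scope classical_set_scope.
Local Open Scope ring_scope.

Definition convex_body (R : realType) (n : nat) (K : set 'cV[R]_n) : Prop :=
  [/\ convex_set K, compact K & interior K !=set0].

Definition symmetric_about (R : realType) (n : nat) (z : 'cV[R]_n)
    (K : set 'cV[R]_n) : Prop :=
  [set x - z | x in K] = [set z - x | x in K].

Definition point_symmetric (R : realType) (n : nat) (K : set 'cV[R]_n) : Prop :=
  exists z, symmetric_about z K.

Definition polar (R : realType) (n : nat) (K : set 'cV[R]_n) : set 'cV[R]_n :=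
  [set a | forall x, K x -> (a^T *m x) 0 0 <= 1].

Definition affine_subspace (R : realType) (n j : nat) (U : set 'cV[R]_n) : Prop :=
  exists (a : 'cV[R]_n) (W : {vspace 'cV[R]_n}),
    \dim W = j /\ U = [set a + w | w in [set` W]].

(* For a nonempty affine subspace U, there is exactly one p in U with x - p
   orthogonal to U, so the default value 0 of xget is never used. *)
Definition orth_proj (R : realType) (n : nat) (U : set 'cV[R]_n)
    (x : 'cV[R]_n) : 'cV[R]_n :=
  xget 0 [set p | U p /\ forall u, U u -> (x - p)^T *m (u - p) = 0].

Definition reflection (R : realType) (n : nat) (U : set 'cV[R]_n)
    (x : 'cV[R]_n) : 'cV[R]_n :=
  2 *: orth_proj U x - x.

(* The infimum is taken in R. For convex bodies, the set below is nonempty and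
   bounded below, so it is the genuine infimum; the same holds for
   chirality j K when j <= n. *)
Definition circumradius (R : realType) (n : nat) (K C : set 'cV[R]_n) : R :=
  inf [set lambda : R | 0 < lambda /\
    exists z : 'cV[R]_n, K `<=` [set z + lambda *: c | c in C]].

Definition chirality (R : realType) (n j : nat) (K : set 'cV[R]_n) : R :=
  inf [set circumradius K (reflection U @` K) | U in affine_subspace j].

(* Main.v *)
(* Reflections in affine subspaces with common direction W differ by
   translations, which the circumradius R does not see, so only the linear
   reflection S_W matters.  Since S_{W^orth} = - S_W and R is submultiplicative,
   R(K, S_{W^orth} K) <= R(K, S_W K) R(K, -K), and alpha_0(K) = R(K, -K).
   If K is point-symmetric, -K is a translate of K and the two radii agree.
   If K is 0-symmetric, convexity lets one drop the translation from
   K c z + lambda S_W K, so that the inclusion means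
   lambda^-1 S_W K c K; as S_W is self-adjoint this passes to the polar body,
   and back by the bipolar theorem. *)
Require Import Defs.
From mathcomp Require Import all_boot all_order all_algebra.
From mathcomp Require Import all_classical all_reals all_analysis.
From mathcomp Require Import zify ring lra.
Import Order.TTheory GRing.Theory Num.Theory.
Import numFieldNormedType.Exports.
Set Implicit Arguments.
Unset Strict Implicit.
Unset Printing Implicit Defensive.
Local Open Scope classical_set_scope.
Local Open Scope ring_scope.

(** * The Euclidean inner product *)

Definition dot {R : realType} {n : nat} (x y : 'cV[R]_n) : R := (x^T *m y) 0 0.

Lemma dotE (R : realType) n (x y : 'cV[R]_n) :
  dot x y = \sum_i x i 0 * y i 0.
Proof. by rewrite /dot mxE; apply: eq_bigr => i _; rewrite mxE. Qed.

Lemma dotC (R : realType) n (x y : 'cV[R]_n) : dot x y = dot y x.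
Proof. by rewrite !dotE; apply: eq_bigr => i _; rewrite mulrC. Qed.

Lemma dotDr (R : realType) n (x y z : 'cV[R]_n) :
  dot x (y + z) = dot x y + dot x z.
Proof. by rewrite /dot mulmxDr mxE. Qed.

Lemma dotZr (R : realType) n a (x y : 'cV[R]_n) : dot x (a *: y) = a * dot x y.
Proof. by rewrite /dot -scalemxAr mxE. Qed.

Lemma dotNr (R : realType) n (x y : 'cV[R]_n) : dot x (- y) = - dot x y.
Proof. by rewrite -scaleN1r dotZr mulN1r. Qed.

Lemma dotDl (R : realType) n (x y z : 'cV[R]_n) :
  dot (x + y) z = dot x z + dot y z.
Proof. by rewrite dotC dotDr !(dotC z). Qed.

Lemma dotZl (R : realType) n a (x y : 'cV[R]_n) : dot (a *: x) y = a * dot x y.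
Proof. by rewrite dotC dotZr dotC. Qed.

Lemma dotNl (R : realType) n (x y : 'cV[R]_n) : dot (- x) y = - dot x y.
Proof. by rewrite dotC dotNr dotC. Qed.

Definition dot_linE := (dotDl, dotDr, dotNl, dotNr, dotZl, dotZr).

Lemma dot_ge0 (R : realType) n (x : 'cV[R]_n) : 0 <= dot x x.
Proof. by rewrite dotE sumr_ge0 // => i _; rewrite -expr2 sqr_ge0. Qed.

Lemma sqr_coord_le_dot (R : realType) n (x : 'cV[R]_n) i :
  x i 0 ^+ 2 <= dot x x.
Proof.
rewrite dotE (bigD1 i) //= -expr2 lerDl sumr_ge0 // => k _.
by rewrite -expr2 sqr_ge0.
Qed.

Lemma dot_eq0 (R : realType) n (x : 'cV[R]_n) : dot x x = 0 -> x = 0.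
Proof.
move=> x0; apply/matrixP => i k; rewrite ord1 mxE.
by apply/eqP; rewrite -sqrf_eq0 eq_le sqr_ge0 -x0 sqr_coord_le_dot.
Qed.

Lemma continuous_dist2 (R : realType) n (y : 'cV[R]_n) :
  continuous (fun x : 'cV[R]_n => dot (x - y) (x - y)).
Proof.
have -> : (fun x : 'cV[R]_n => dot (x - y) (x - y)) =
          (fun x => \sum_(i < n) (x i 0 - y i 0) * (x i 0 - y i 0)).
  by apply/funext => x; rewrite dotE; apply: eq_bigr => i _; rewrite !mxE.
apply: continuous_big => [|i _].
  exact: add_continuous.
have H : continuous (fun x : 'cV[R]_n => x i 0 - y i 0).
  move=> x.
  apply: (@continuousB _ _ _ (fun x : 'cV[R]_n => x i 0) (cst (y i 0))).
    exact: coord_continuous.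
  exact: cst_continuous.
by move=> x; exact: continuousM (H x) (H x).
Qed.

(** * Orthogonal complements of subspaces *)

Definition orthv {R : realType} {n : nat} (W : {vspace 'cV[R]_n}) :
    {vspace 'cV[R]_n} :=
  lker (linfun (mulmx (\matrix_(i < \dim W) ((vbasis W)`_i)^T))).

Lemma orthvP (R : realType) n (W : {vspace 'cV[R]_n}) (x : 'cV[R]_n) :
  reflect (forall w, w \in W -> dot w x = 0) (x \in orthv W).
Proof.
rewrite memv_ker lfunE /=.
set B := (\matrix_(i < _) _).
have Bx (i : 'I_(\dim W)) : (B *m x) i 0 = dot (vbasis W)`_i x.
  by rewrite dotE mxE; apply: eq_bigr => k _; rewrite !mxE.
apply: (iffP eqP) => [Bx0 w wW|Wx].
  rewrite (coord_vbasis wW) dotC.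
  elim/big_rec: _ => [|i y _ IH]; first by rewrite -(scale0r 0) dotZr mul0r.
  by rewrite dotDr dotZr IH dotC -Bx Bx0 mxE mulr0 addr0.
apply/matrixP => i k; rewrite ord1 Bx mxE Wx //.
by rewrite vbasis_mem // mem_nth // size_tuple.
Qed.

Lemma capv_orthv (R : realType) n (W : {vspace 'cV[R]_n}) :
  (W :&: orthv W = 0)%VS.
Proof.
apply/eqP; rewrite -subv0; apply/subvP => x /memv_capP[xW /orthvP Wx].
by rewrite memv0; apply/eqP/dot_eq0/Wx.
Qed.

Lemma dimvf_cV (R : realType) n : \dim (fullv : {vspace 'cV[R]_n}) = n.
Proof. by rewrite dimvf dim_matrix mulr1. Qed.

Lemma dimv_cV_le (R : realType) n (W : {vspace 'cV[R]_n}) : (\dim W <= n)%N.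
Proof.
by have := dimvS (subvf W); rewrite dimvf_cV.
Qed.

(** The sum is at most [n] because the two spaces meet trivially. It is at least [n] by
    rank-nullity: [orthv W] is the kernel of a map into a space of dimension [\dim W]. *)
Lemma dimD_orthv (R : realType) n (W : {vspace 'cV[R]_n}) :
  (\dim W + \dim (orthv W))%N = n.
Proof.
apply/eqP; rewrite eqn_leq; apply/andP; split.
  by rewrite -(dimv_disjoint_sum (capv_orthv W)) dimv_cV_le.
have := limg_ker_dim (linfun (mulmx (\matrix_(i < \dim W) ((vbasis W)`_i)^T)))
          (fullv : {vspace 'cV[R]_n}).
rewrite capfv dimvf_cV => {1}<-.
by rewrite addnC leq_add2r dimv_cV_le.
Qed.

Lemma addv_orthv (R : realType) n (W : {vspace 'cV[R]_n}) :
  (W + orthv W = fullv)%VS.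
Proof.
apply/eqP; rewrite eqEdim subvf dimvf_cV.
by rewrite (dimv_disjoint_sum (capv_orthv W)) dimD_orthv leqnn.
Qed.

Lemma orthvK (R : realType) n (W : {vspace 'cV[R]_n}) : orthv (orthv W) = W.
Proof.
apply/esym/eqP; rewrite eqEdim; apply/andP; split; last first.
  rewrite -(leq_add2l (\dim (orthv W))) dimD_orthv.
  by rewrite addnC dimD_orthv.
apply/subvP => x xW; apply/orthvP => y /orthvP Wy.
by rewrite dotC Wy.
Qed.

Lemma dim_orthv (R : realType) n (W : {vspace 'cV[R]_n}) :
  \dim (orthv W) = (n - \dim W)%N.
Proof. by have := dimD_orthv W; lia. Qed.

(** Ensures that [chirality j K] is an infimum over a nonempty set when [j <= n]. *)
Lemma exists_dimv (R : realType) n j :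
  (j <= n)%N -> exists W : {vspace 'cV[R]_n}, \dim W = j.
Proof.
move=> jn; exists <<take j (vbasis (fullv : {vspace 'cV[R]_n}))>>%VS.
set b := vbasis _.
have : free (take j b ++ drop j b).
  by rewrite cat_take_drop (basis_free (vbasisP _)).
move=> /catl_free; rewrite /free => /eqP ->; rewrite size_takel //.
by rewrite size_tuple dimvf_cV.
Qed.

(** * Linear reflections *)

Definition mirror {R : realType} {n : nat} (W : {vspace 'cV[R]_n}) :
    'End('cV[R]_n) :=
  2 *: daddv_pi W (orthv W) - \1%VF.

Lemma mirrorE (R : realType) n (W : {vspace 'cV[R]_n}) x :
  mirror W x = 2 *: daddv_pi W (orthv W) x - x.
Proof. by rewrite /mirror !lfunE /= !lfunE /= id_lfunE. Qed.

Lemma daddv_pi_orthv (R : realType) n (W : {vspace 'cV[R]_n}) x :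
  daddv_pi W (orthv W) x + daddv_pi (orthv W) W x = x.
Proof. by rewrite daddv_pi_add ?capv_orthv // addv_orthv memvf. Qed.

(** If $x=p+q$ with $p$ in [W] and $q$ in [orthv W], the two mirrors send $x$ to $p-q$ and to
    $q-p$. *)
Lemma mirror_orthv (R : realType) n (W : {vspace 'cV[R]_n}) x :
  mirror (orthv W) x = - mirror W x.
Proof.
rewrite !mirrorE orthvK -{2 4}(daddv_pi_orthv W x) !scaler_nat !mulr2n.
set p := daddv_pi W _ _; set q := daddv_pi _ W _.
by apply/matrixP => i k; rewrite !mxE; lra.
Qed.

Lemma dot_daddv_pi (R : realType) n (W : {vspace 'cV[R]_n}) w x :
  w \in W -> dot w (daddv_pi W (orthv W) x) = dot w x.
Proof.
move=> wW; rewrite -[in RHS](daddv_pi_orthv W x) dotDr.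
by rewrite (orthvP _ _ (memv_pi (orthv W) W x)) // addr0.
Qed.

(** Writing $P$ for the projection onto [W], both $\langle Px,y\rangle$ and $\langle x,Py\rangle$
    equal $\langle Px,Py\rangle$. *)
Lemma mirror_selfadjoint (R : realType) n (W : {vspace 'cV[R]_n}) x y :
  dot (mirror W x) y = dot x (mirror W y).
Proof.
rewrite !mirrorE !dot_linE; congr (2 * _ - _).
rewrite -(dot_daddv_pi y (memv_pi W _ x)).
by rewrite dotC (dot_daddv_pi x (memv_pi W _ y)) dotC.
Qed.

Lemma mirrorK (R : realType) n (W : {vspace 'cV[R]_n}) :
  involutive (mirror W).
Proof.
move=> x; rewrite !mirrorE linearB linearZ /=.
rewrite (daddv_pi_proj _ (capv_orthv W)).
by apply/matrixP => i k; rewrite !mxE; lra.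
Qed.

Lemma mirror0 (R : realType) n (x : 'cV[R]_n) : mirror 0%VS x = - x.
Proof.
rewrite mirrorE; have := memv_pi 0%VS (orthv 0) x.
by rewrite memv0 => /eqP ->; rewrite scaler0 sub0r.
Qed.

Lemma dot_mirror (R : realType) n (W : {vspace 'cV[R]_n}) x :
  dot (mirror W x) (mirror W x) = dot x x.
Proof. by rewrite mirror_selfadjoint mirrorK. Qed.

Lemma reflection_mirror (R : realType) n (a : 'cV[R]_n)
    (W : {vspace 'cV[R]_n}) x :
  reflection [set a + w | w in [set` W]] x = a + mirror W (x - a).
Proof.
rewrite /reflection.
suff -> : orth_proj [set a + w | w in [set` W]] x
          = a + daddv_pi W (orthv W) (x - a).
  by rewrite mirrorE; apply/matrixP => i k; rewrite !mxE; lra.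
set p := a + _.
have Up : [set a + w | w in [set` W]] p.
  by exists (daddv_pi W (orthv W) (x - a)) => //=; exact: memv_pi.
have orthp u : [set a + w | w in [set` W]] u -> (x - p)^T *m (u - p) = 0.
  move=> [w /= wW <-]; apply/matrixP => i k; rewrite !ord1 [RHS]mxE.
  have -> : x - p = daddv_pi (orthv W) W (x - a).
    by rewrite /p opprD addrA -{1}(daddv_pi_orthv W (x - a)) addrC addKr.
  have -> : a + w - p = w - daddv_pi W (orthv W) (x - a).
    by apply/matrixP => i' k'; rewrite !mxE; lra.
  rewrite -/(dot _ _) dotC (orthvP _ _ (memv_pi (orthv W) W (x - a))) //.
  by rewrite rpredB // memv_pi.
apply: xget_unique => [|q [Uq orthq]]; first by split.
(* Uniqueness of the foot point: the next two relations add up to $|q-p|^2=0$. *)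
have xp0 : dot (x - p) (q - p) = 0 by rewrite /dot orthp // mxE.
have xq0 : dot (x - q) (p - q) = 0 by rewrite /dot orthq // mxE.
apply/eqP; rewrite -subr_eq0; apply/eqP/dot_eq0.
clearbody p; move: xp0 xq0; rewrite !dot_linE !(dotC p) (dotC x q); lra.
Qed.

(** * Dilation factors for a fixed direction *)

(* The set of dilation factors over which circumradius K (reflection U @` K)
   is an infimum, when W is the direction of U: it does not depend on the
   position of U because the translation z is free. *)
Definition mirror_ratios {R : realType} {n : nat} (K : set 'cV[R]_n)
    (W : {vspace 'cV[R]_n}) : set R :=
  [set lambda | 0 < lambda /\ exists z, forall k, K k ->
    exists2 k', K k' & k = z + lambda *: mirror W k'].

Lemma circumradius_reflection (R : realType) n (K : set 'cV[R]_n) a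
    (W : {vspace 'cV[R]_n}) :
  circumradius K (reflection [set a + w | w in [set` W]] @` K)
  = inf (mirror_ratios K W).
Proof.
congr inf; apply/seteqP; split=> l [l0 [z Kz]]; split => //.
  (* Reflection across $a+W$ is [mirror W] followed by translation by [a - mirror W a]. *)
  exists (z + l *: (a - mirror W a)) => k /Kz[_ [k' Kk' <-] <-].
  exists k' => //; rewrite reflection_mirror [mirror W (_ - _)]linearB /=.
  by apply/matrixP => i j; rewrite !mxE; ring.
exists (z - l *: (a - mirror W a)) => k /Kz[k' Kk' ->].
exists (reflection [set a + w | w in [set` W]] k'); first by exists k'.
rewrite reflection_mirror [mirror W (_ - _)]linearB /=.
by apply/matrixP => i j; rewrite !mxE; ring.
Qed.

Lemma chirality_mirror (R : realType) n j (K : set 'cV[R]_n) :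
  chirality j K = inf [set inf (mirror_ratios K W) | W in [set W | \dim W = j]].
Proof.
congr inf; apply/seteqP; split => [_ [U [a [W [Wj ->]]] <-]|_ [W /= Wj <-]].
  by exists W; rewrite // circumradius_reflection.
exists [set (0 : 'cV[R]_n) + w | w in [set` W]].
  by exists 0, W.
by rewrite circumradius_reflection.
Qed.

(** Substitute $K\subset y-mK$ into $K\subset z+lS_WK$; the minus sign turns $S_W$ into the mirror
    of the complement. *)
Lemma mirror_ratios_mul (R : realType) n (K : set 'cV[R]_n)
    (W : {vspace 'cV[R]_n}) l m :
  mirror_ratios K W l -> mirror_ratios K 0 m ->
  mirror_ratios K (orthv W) (l * m).
Proof.
move=> [l0 [z Kz]] [m0 [y Ky]]; split; first exact: mulr_gt0.
exists (z + l *: mirror W y) => k /Kz[_ /Ky[k2 Kk2 ->] ->].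
exists k2 => //; rewrite mirror0 mirror_orthv linearD linearZ /= linearN /=.
by apply/matrixP => i j; rewrite !mxE; ring.
Qed.

(** Since $K=2c-K$, the sign change between the two mirrors costs only a translation. One inclusion
    for every subspace suffices, as [orthv] is an involution. *)
Lemma mirror_ratios_point_symmetric (R : realType) n (K : set 'cV[R]_n)
    (W : {vspace 'cV[R]_n}) :
  point_symmetric K -> mirror_ratios K (orthv W) = mirror_ratios K W.
Proof.
move=> [c /seteqP[sK _]].
have cK k : K k -> exists2 k', K k' & k = 2 *: c - k'.
  move=> Kk; have [|k' Kk' kk'] := sK (k - c); first by exists k.
  exists k' => //; move/matrixP: kk' => kk'; apply/matrixP => i j.
  by have := kk' i j; rewrite !mxE; lra.
have sub V : mirror_ratios K V `<=` mirror_ratios K (orthv V).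
  move=> l [l0 [z Kz]]; split => //.
  exists (z + (2 * l) *: mirror V c) => k /Kz[k1 /cK[k2 Kk2 ->] ->].
  exists k2 => //; rewrite mirror_orthv linearB linearZ /=.
  by apply/matrixP => i j; rewrite !mxE; ring.
by apply/seteqP; split; [rewrite -{2}(orthvK W)|]; exact: sub.
Qed.

Lemma compact_dot_bounded (R : realType) n (K : set 'cV[R]_n) :
  compact K -> exists M, forall x, K x -> dot x x <= M.
Proof.
move=> cK; have [->|K0] := eqVneq K set0; first by exists 0.
have cont : {within K, continuous (fun x => dot (x - 0) (x - 0))}.
  exact: continuous_subspaceT (@continuous_dist2 R n 0).
move/set0P in K0; have [c _ cmax] := compact_EVT_max K0 cK cont.
exists (dot c c) => x Kx; have := cmax x; rewrite !subr0; apply.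
exact/mem_set.
Qed.

Lemma mirror_ratios_nonempty (R : realType) n (K : set 'cV[R]_n)
    (W : {vspace 'cV[R]_n}) :
  convex_body K -> mirror_ratios K W !=set0.
Proof.
move=> [_ /compact_dot_bounded[M KM] [x0]].
rewrite /interior => /nbhs_ballP[e /= e0 ballK].
(* The ball is a sup-norm ball, so it is enough that each coordinate of [mirror W k] stays below
   $el=1+M^2$. Its square is at most $M$, and $1+M^2>\sqrt M$. *)
pose l := e^-1 * (1 + M ^+ 2).
have l0 : 0 < l.
  by rewrite mulr_gt0 ?invr_gt0 // ltr_wpDr ?sqr_ge0.
exists l; split => //; exists (- l *: mirror W x0) => k Kk.
exists (x0 + l^-1 *: mirror W k); last first.
  rewrite [mirror W (_ + _)]linearD /= [mirror W (_ *: _)]linearZ /=.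
  rewrite mirrorK scalerDr scalerA mulfV ?gt_eqF // scale1r.
  by rewrite scaleNr addrA addNr add0r.
apply: ballK; split => // i j; rewrite (ord1 j) /ball /= !mxE.
rewrite opprD addrA subrr add0r normrN normrM gtr0_norm ?invr_gt0 //.
rewrite mulrC ltr_pdivrMr // /l mulrA mulfV ?gt_eqF // mul1r.
have := sqr_coord_le_dot (mirror W k) i; rewrite dot_mirror => kM.
have := le_trans kM (KM _ Kk); rewrite -real_normK ?num_real //.
set t := `|_|; have t0 : 0 <= t by exact: normr_ge0.
move=> tM; have := sqr_ge0 (t - 1); have := sqr_ge0 (M - 1); nra.
Qed.

(** * Infima and the product bound *)

Lemma inf_ge0 (R : realType) (A : set R) :
  (forall a, A a -> 0 <= a) -> 0 <= inf A.
Proof.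
move=> A0; have [->|/set0P An0] := eqVneq A set0; first by rewrite inf0.
exact: lb_le_inf.
Qed.

(** Lets a product bound pass to the infimum one factor at a time. At [c = 0], where division is
    impossible, any element of [A] gives the claim. *)
Lemma inf_image_mulr_ge (R : realType) (A : set R) x c : A !=set0 -> 0 <= c ->
  (forall a, A a -> x <= a * c) -> x <= inf A * c.
Proof.
move=> A0; rewrite le_eqVlt => /predU1P[<-|c0] xA.
  by have [a /xA] := A0; rewrite !mulr0.
by rewrite -ler_pdivrMr //; apply: lb_le_inf => // a /xA; rewrite ler_pdivrMr.
Qed.

Lemma inf_mirror_ratios_ge0 (R : realType) n (K : set 'cV[R]_n)
    (W : {vspace 'cV[R]_n}) : 0 <= inf (mirror_ratios K W).
Proof. by apply: inf_ge0 => a [/ltW]. Qed.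

Lemma chirality_ge0 (R : realType) n j (K : set 'cV[R]_n) : 0 <= chirality j K.
Proof.
by rewrite chirality_mirror; apply: inf_ge0 => _ [W _ <-];
  exact: inf_mirror_ratios_ge0.
Qed.

Lemma inf_mirror_ratios_orthv (R : realType) n (K : set 'cV[R]_n)
    (W : {vspace 'cV[R]_n}) : convex_body K ->
  inf (mirror_ratios K (orthv W))
    <= inf (mirror_ratios K W) * inf (mirror_ratios K 0).
Proof.
move=> hK; apply: inf_image_mulr_ge => [||l Kl].
- exact: mirror_ratios_nonempty.
- exact: inf_mirror_ratios_ge0.
rewrite mulrC; apply: inf_image_mulr_ge => [||m Km].
- exact: mirror_ratios_nonempty.
- by case: Kl => /ltW.
rewrite mulrC; apply: ge_inf; last exact: mirror_ratios_mul.
by exists 0 => a [/ltW].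
Qed.

(** The zero subspace is the only one of dimension 0, so the outer infimum runs over a single
    value. *)
Lemma chirality0 (R : realType) n (K : set 'cV[R]_n) :
  chirality 0 K = inf (mirror_ratios K 0).
Proof.
rewrite chirality_mirror -[RHS]inf1; congr inf.
apply/seteqP; split => [l [W /= /eqP]|_ ->].
  by rewrite dimv_eq0 => /eqP -> <-.
by exists 0%VS; rewrite //= dimv0.
Qed.

Lemma chirality_compl_le (R : realType) n (K : set 'cV[R]_n) j :
  convex_body K -> (j <= n)%N ->
  chirality (n - j) K <= chirality j K * chirality 0 K.
Proof.
move=> hK jn; rewrite [chirality j K]chirality_mirror.
apply: inf_image_mulr_ge; last 2 first.
- exact: chirality_ge0.
- move=> _ [W /= Wj <-]; rewrite chirality0.
  apply: le_trans (inf_mirror_ratios_orthv W hK).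
  rewrite chirality_mirror; apply: ge_inf.
    by exists 0 => _ [V _ <-]; exact: inf_mirror_ratios_ge0.
  by exists (orthv W) => //=; rewrite dim_orthv Wj.
have [W Wj] := exists_dimv R jn.
by exists (inf (mirror_ratios K W)), W.
Qed.

Lemma chirality_div_le (R : realType) n (K : set 'cV[R]_n) j :
  convex_body K -> (j <= n)%N ->
  chirality (n - j) K / chirality j K <= chirality 0 K.
Proof.
move=> hK jn; have := chirality_ge0 j K; rewrite le_eqVlt => /predU1P[<-|a0].
  (* A zero denominator does occur, for [n = 0]; the convention $0^{-1}=0$ then makes the quotient
     0. *)
  by rewrite invr0 mulr0 chirality_ge0.
by rewrite ler_pdivrMr // mulrC chirality_compl_le.
Qed.

Lemma chirality_point_symmetric (R : realType) n (K : set 'cV[R]_n) j :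
  (j <= n)%N -> point_symmetric K -> chirality j K = chirality (n - j) K.
Proof.
move=> jn sK; rewrite !chirality_mirror; congr inf.
apply/seteqP; split => _ [W /= Wj <-]; exists (orthv W);
  rewrite /= ?mirror_ratios_point_symmetric // dim_orthv Wj //.
exact: subKn.
Qed.

(** * Polarity and 0-symmetric bodies *)

Lemma convex_set_conv (R : realType) n (K : set 'cV[R]_n) x y t :
  convex_set K -> K x -> K y -> 0 <= t -> t <= 1 -> K (t *: x + (1 - t) *: y).
Proof.
move=> cK Kx Ky t0 t1.
have t01 : Itv.spec (@Itv.num_sem R) (Itv.Real `[0%Z, 1%Z]) t.
  by rewrite /= /Itv.num_sem/= realE t0 /= in_itv /= t0 t1.
exact: (set_mem (cK x y (Itv.mk t01) (mem_set Kx) (mem_set Ky))).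
Qed.

Lemma mirror_ratios_central (R : realType) n (K : set 'cV[R]_n)
    (W : {vspace 'cV[R]_n}) l :
  convex_set K -> (forall x, K x -> K (- x)) ->
  mirror_ratios K W l <->
  0 < l /\ forall x, K x -> K (l^-1 *: mirror W x).
Proof.
move=> cK sK; split=> [[l0 [z Kz]]|[l0 Kl]]; split => //; last first.
  exists 0 => k Kk; exists (l^-1 *: mirror W k); first exact: Kl.
  by rewrite linearZ /= mirrorK scalerA mulfV ?gt_eqF // scale1r add0r.
move=> x Kx; have [k1 Kk1 xk1] := Kz _ Kx; have [k2 Kk2 xk2] := Kz _ (sK _ Kx).
(* Half the difference of the expressions for $x$ and $-x$ cancels $z$ and leaves the midpoint of
   $k_1$ and $-k_2$. *)
have -> : x = l *: mirror W (2^-1 *: k1 + (1 - 2^-1) *: - k2).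
  rewrite linearD !linearZ /= linearN /=.
  apply/matrixP => i j; move/matrixP/(_ i j): xk1; move/matrixP/(_ i j): xk2.
  by rewrite !mxE; lra.
rewrite linearZ /= mirrorK scalerA mulVf ?gt_eqF // scale1r.
by apply: convex_set_conv; [|exact: Kk1|exact: sK|lra|lra].
Qed.

Lemma convex_polar (R : realType) n (K : set 'cV[R]_n) : convex_set (polar K).
Proof.
move=> a b t /set_mem Ka /set_mem Kb; apply/mem_set => x Kx.
have := Ka x Kx; have := Kb x Kx; rewrite -!/(dot _ _) => bx ax.
have t0 : 0 <= t%:num by exact: ge0.
have t1 : t%:num <= 1 by exact: le1.
change (dot (t%:num *: a + (1 - t%:num) *: b) x <= 1).
rewrite !dot_linE; nra.
Qed.

Lemma polarN (R : realType) n (K : set 'cV[R]_n) :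
  (forall x, K x -> K (- x)) -> forall a, polar K a -> polar K (- a).
Proof.
move=> sK a Ka x Kx; have := Ka _ (sK _ Kx).
by rewrite -!/(dot _ _) dotNl dotNr.
Qed.

(** For $a\in K^\circ$ and $x\in K$, $\langle l^{-1}S_Wa,x\rangle=\langle a,l^{-1}S_Wx\rangle\le
    1$. *)
Lemma mirror_ratios_polar_sub (R : realType) n (K : set 'cV[R]_n)
    (W : {vspace 'cV[R]_n}) :
  convex_set K -> (forall x, K x -> K (- x)) ->
  mirror_ratios K W `<=` mirror_ratios (polar K) W.
Proof.
move=> cK sK l /(mirror_ratios_central _ _ cK sK)[l0 Kl].
apply/(mirror_ratios_central _ _ (@convex_polar _ _ K) (polarN sK)).
split => // a Ka x Kx.
by rewrite -/(dot _ _) dotZl mirror_selfadjoint -dotZr Ka //; exact: Kl.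
Qed.

(** A point $y\notin K$ is separated from $K$ by the hyperplane normal to $v=y-c$, where $c$ is the
    point of $K$ nearest to $y$. *)
Lemma polar_polar (R : realType) n (K : set 'cV[R]_n) :
  convex_set K -> compact K -> K 0 -> polar (polar K) = K.
Proof.
move=> cK kK K0; apply/seteqP; split=> y; last first.
  by move=> Ky a Ka; have := Ka y Ky; rewrite -!/(dot _ _) dotC.
apply: contraPP => nKy PKy.
have cont : {within K, continuous (fun x => dot (x - y) (x - y))}.
  exact: continuous_subspaceT (@continuous_dist2 R n y).
have Kn0 : K !=set0 by exists 0.
have [c /set_mem Kc cmin] := compact_EVT_min Kn0 kK cont.
have [v vE] : exists v, v = y - c by exists (y - c).
have vv_gt0 : 0 < dot v v.
  rewrite lt_neqAle dot_ge0 andbT eq_sym; apply/eqP => /dot_eq0/eqP; rewrite vE.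
  by rewrite subr_eq0 => /eqP yc; apply: nKy; rewrite yc.
have Kv x : K x -> dot v x <= dot v c.
  move=> Kx; rewrite leNgt; apply/negP => vcx.
  have [w wE] : exists w, w = x - c by exists (x - c).
  pose s := dot v w; pose q := dot w w.
  have s0 : 0 < s by rewrite /s wE dotDr dotNr; lra.
  have q0 : 0 <= q by exact: dot_ge0.
  (* Moving from $c$ towards $x$ by $t$ changes the squared distance to $y$ by $t(tq-2s)$. This $t$
     lies in $(0,1]$ and has $tq<s$, so the distance drops, against the choice of $c$. *)
  pose t := s / (s + q).
  have tsq : t * (s + q) = s by rewrite /t divfK // gt_eqF //; lra.
  have t0 : 0 < t by rewrite divr_gt0 //; lra.
  have t1 : t <= 1 by rewrite ler_pdivrMr; lra.
  have := cmin _ (mem_set (convex_set_conv cK Kx Kc (ltW t0) t1)).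
  have -> : t *: x + (1 - t) *: c - y = t *: w - v.
    by rewrite wE vE; apply/matrixP => i j; rewrite !mxE; ring.
  rewrite -[c - y]opprB -vE !dot_linE (dotC w v) -/s -/q; nra.
have vc0 : 0 <= dot v c.
  by have := Kv _ K0; rewrite -[X in dot v X](scale0r 0) dotZr mul0r.
have vy : dot v y = dot v c + dot v v.
  by rewrite -dotDr; congr dot; rewrite vE addrC subrK.
(* Halfway between the maximum $\langle v,c\rangle$ of $v$ on $K$ and $\langle v,y\rangle$. It is
   positive because $0\in K$, so $v/b$ lies in $K^\circ$ yet exceeds 1 at $y$. *)
pose b := dot v c + dot v v / 2.
have b0 : 0 < b by rewrite /b; lra.
have : polar K (b^-1 *: v).
  move=> x Kx; rewrite -/(dot _ _) dotZl mulrC ler_pdivrMr // mul1r.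
  by have := Kv x Kx; rewrite /b; lra.
move=> /PKy; rewrite -/(dot _ _) dotZr (dotC y) vy mulrC.
rewrite ler_pdivrMr // mul1r /b.
lra.
Qed.

Lemma chirality_polar (R : realType) n (K : set 'cV[R]_n) j :
  convex_body K -> symmetric_about 0 K -> chirality j K = chirality j (polar K).
Proof.
move=> [cK kK [x0 /interior_subset Kx0]] /seteqP[sub0 _].
have sK x : K x -> K (- x).
  move=> Kx; have [|y Ky] := sub0 x; first by exists x => //; rewrite subr0.
  by rewrite sub0r => <-; rewrite opprK.
have K0 : K 0.
  have := @convex_set_conv R n K x0 (- x0) 2^-1 cK Kx0 (sK _ Kx0).
  have -> : 2^-1 *: x0 + (1 - 2^-1) *: - x0 = 0.
    by apply/matrixP => i k; rewrite !mxE; lra.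
  by apply; lra.
rewrite !chirality_mirror; congr inf; apply: eq_imagel => W _; congr inf.
apply/seteqP; split; first exact: mirror_ratios_polar_sub.
(* The reverse inclusion is the same lemma applied to the polar body. *)
rewrite -{2}(polar_polar cK kK K0).
by apply: mirror_ratios_polar_sub; [exact: convex_polar|exact: polarN].
Qed.

Theorem theorem3p8 (R : realType) (n : nat) (K : set 'cV[R]_n) (j : nat)
    (hK : convex_body K) (hj : (j <= n)%N) :
  [/\ Num.max (chirality j K / chirality (n - j) K)
              (chirality (n - j) K / chirality j K) <= chirality 0 K,
      point_symmetric K -> chirality j K = chirality (n - j) K
    & symmetric_about 0 K -> chirality j K = chirality j (polar K)].
Proof.
split.
- rewrite ge_max chirality_div_le // andbT.
  by have := chirality_div_le hK (leq_subr j n); rewrite subKn.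
- exact: chirality_point_symmetric.
- exact: chirality_polar.
Qed.
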